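(* Assume the setting of the context, fix a compact interval $I\subset(0,\infty)$ and $r>0$, and suppose Assumptions (Â1) and (Â2) hold. Then \[\lim_{n\rightarrow\infty}\sup_{x,y\in B_F(\rho,r)}\sup_{t\in I}\left|\beta(n)q^n_{\lfloor\gamma(n)t\rfloor}(g_n(x),g_n(y))-p_t(x,y)\right|=0.\]
   Context: Let $(E,d_E)$ be a metric space and $F\subseteq E$ such that $F\cap\overline{B}_E(x,r)$ is compact for all $x\in E$, $r>0$ ($\overline{B}_E$, $B_E$ closed and open balls in $E$). Let $d_F:=d_E|_{F\times F}$, $B_F(x,r)$ the open ball in $(F,d_F)$, $\rho\in F$, and $\nu$ a Radon measure of full support on $(F,d_F)$ (extended to $E$ by $\nu(A):=\nu(A\cap F)$). Let $X=((X_t)_{t\ge0},\mathbf{P}_x,x\in F)$ be a conservative $\nu$-symmetric Markov diffusion on $F$ with transition density $(p_t(x,y))_{x,y\in F,t>0}$ (with respect to $\nu$) jointly continuous in $(t,x,y)$. For a locally finite connected graph $G$ with at least two vertices: $d_G$ is the shortest-path metric, $B_G(x,r)$ the open $d_G$-ball; $\mu^G$ a symmetric weight with $\mu^G_{xy}>0$ iff $\{x,y\}$ is an edge; $\mu^G_x:=\sum_y\mu^G_{xy}$; $\nu^G(A):=\sum_{x\in A}\mu^G_x$; $X^G$ the discrete time simple random walk with $P_G(x,y)=\mu^G_{xy}/\mu^G_x$, law $\mathbf{P}^G_x$ from $x$; $p^G_m(x,y):=\mathbf{P}^G_x(X^G_m=y)/\nu^G(\{y\})$, $q^G_m(x,y):=\frac12(p^G_m(x,y)+p^G_{m+1}(x,y))$.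 $(G^n)_{n\ge1}$ are such graphs with $V(G^n)\subseteq E$ and distinguished vertex $\rho\in V(G^n)$; write $\nu^n,X^n,q^n$ for $\nu^{G^n},X^{G^n},q^{G^n}$. $(\alpha(n)),(\beta(n)),(\gamma(n))$ are non-negative sequences diverging to $\infty$. For $x\in E$, $g_n(x)$ is a point of $V(G^n)$ minimising $d_E(x,\cdot)$. Assumption (Â1): (a) there is $c_1>0$ with $d_{G^n}(x,y)\ge c_1\alpha(n)d_E(x,y)$ for all $x,y\in V(G^n)$, $n\ge1$, and a non-negative $\tilde\alpha(n)=o(\alpha(n))$ such that for each $r>0$ there are $c_2<\infty$, $n_0$ with $d_{G^n}(x,y)\le c_2\alpha(n)d_E(x,y)+\tilde\alpha(n)$ for all $x,y\in V(G^n)\cap B_E(\rho,r)$, $n\ge n_0$; (b) for each $r>0$, $\lim_n\sup_{x\in B_F(\rho,r)}d_E(x,V(G^n))=0$; (c) for every $x\in F$, $r>0$, $\lim_n\beta(n)^{-1}\nu^n(B_E(x,r))=\nu(B_E(x,r))$; (d) there is a dense subset $F^*\subseteq F$ such that for every compact interval $I\subset(0,\infty)$, $x\in F^*$, $y\in F$, $r>0$, $\lim_n\mathbf{P}^{G^n}_{g_n(x)}(X^n_{\lfloor\gamma(n)t\rfloor}\in B_E(y,r))=\mathbf{P}_x(X_t\in B_E(y,r))$ uniformly for $t\in I$. Assumption (Â2): for every compact interval $I\subset(0,\infty)$ and $r>0$, \[\lim_{\delta\to0}\limsup_{n\to\infty}\sup_{\substack{x,y,z\in B_{G^n}(\rho,\alpha(n)r):\\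 d_{G^n}(y,z)\le\alpha(n)\delta}}\sup_{t\in I}\beta(n)\left|q^n_{\lfloor\gamma(n)t\rfloor}(x,y)-q^n_{\lfloor\gamma(n)t\rfloor}(x,z)\right|=0.\] *)

(* Defs.v *)
From HB Require Import structures.
From mathcomp Require Import all_boot all_order all_algebra.
From mathcomp Require Import all_classical all_reals all_analysis.
Set Implicit Arguments. Unset Strict Implicit. Unset Printing Implicit Defensive.
Import Order.TTheory GRing.Theory Num.Theory.
Import numFieldNormedType.Exports.
Local Open Scope classical_set_scope.
Local Open Scope ring_scope.

Section MetricDefs.
Context {R : realType} {E : Type}.
Implicit Types (dE : E -> E -> R).

Definition is_metric dE : Prop :=
  [/\ (forall x y, 0 <= dE x y), (forall x y, dE x y = 0 <-> x = y),
      (forall x y, dE x y = dE y x)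
    & (forall x y z, dE x z <= dE x y + dE y z)].

Definition mball dE (x : E) (r : R) : set E := [set y | dE x y < r].
Definition mcball dE (x : E) (r : R) : set E := [set y | dE x y <= r].

Definition mopen dE (U : set E) : Prop :=
  forall x, U x -> exists2 e : R, 0 < e & mball dE x e `<=` U.

Definition mcompact dE (K : set E) : Prop :=
  forall (I : Type) (U : I -> set E), (forall i, mopen dE (U i)) ->
    K `<=` \bigcup_i U i ->
    exists J : set I, finite_set J /\ K `<=` \bigcup_(i in J) U i.
End MetricDefs.

(** ** Weighted graphs with vertex set [V] in [E]; the edge set is
    [{x,y}] with [mu x y > 0]. *)
Section GraphDefs.
Context {R : realType} {E : choiceType}.
Implicit Types (V : set E) (mu : E -> E -> R).

Definition gwalk mu (x y : E) (n : nat) : Prop :=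
  exists f : nat -> E, [/\ f 0%N = x, f n = y &
     forall i, (i < n)%N -> 0 < mu (f i) (f i.+1)].

Definition wgraph V mu : Prop :=
  [/\ (forall x y, mu x y = mu y x) /\ (forall x y, 0 <= mu x y),
      (forall x y, 0 < mu x y -> V x /\ V y) /\ (forall x, mu x x = 0),
      (forall x, V x -> finite_set [set y | 0 < mu x y]),
      (forall x y, V x -> V y -> exists n, gwalk mu x y n)
    & exists x y, [/\ V x, V y & x <> y]].

Definition gdist mu (x y : E) : R :=
  inf [set (n%:R : R) | n in [set n | gwalk mu x y n]].

Definition gball V mu (x : E) (r : R) : set E :=
  [set y | V y /\ gdist mu x y < r].

Definition vweight mu (x : E) : R := \sum_(y \in [set y | 0 < mu x y]) mu x y.

Definition gmeasure V mu (A : set E) : \bar R :=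
  (\esum_(x in A `&` V) (vweight mu x)%:E)%E.

Definition gtrans mu (x y : E) : R := mu x y / vweight mu x.

Fixpoint gstep mu (m : nat) (x y : E) : R :=
  match m with
  | 0%N => if `[< x = y >] then 1 else 0
  | m'.+1 => \sum_(z \in [set z | 0 < mu x z]) gtrans mu x z * gstep mu m' z y
  end.

Definition gprob mu (m : nat) (x : E) (A : set E) : R :=
  \sum_(y \in A) gstep mu m x y.

Definition gdens mu (m : nat) (x y : E) : R := gstep mu m x y / vweight mu y.
Definition gq mu (m : nat) (x y : E) : R :=
  (gdens mu m x y + gdens mu m.+1 x y) / 2.
End GraphDefs.

Section LimitDefs.
Context {R : realType} {d : measure_display} {E : measurableType d}.
Implicit Types (dE : E -> E -> R) (F : set E) (nu : {measure set E -> \bar R}).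

(** [nu] is (the extension to E of) a Radon measure of full support on
    (F, d_F), w.r.t. the Borel sigma-algebra *)
Definition radon_full_support dE F nu : Prop :=
  [/\ measurable F /\
      (forall A, measurable A -> nu A = nu (A `&` F)),
      (forall K, K `<=` F -> mcompact dE K -> (nu K < +oo)%E),
      (forall A, measurable A -> A `<=` F ->
         nu A = ereal_inf [set nu (O `&` F) | O in [set O | mopen dE O /\ A `<=` O]]),
      (forall O, mopen dE O ->
         nu (O `&` F) = ereal_sup [set nu K | K in [set K | K `<=` O `&` F /\ mcompact dE K]])
    & (forall x r, F x -> 0 < r -> (0 < nu (mball dE x r `&` F))%E)].

Definition sym_transition_density dE F nu (p : R -> E -> E -> R) : Prop :=
  [/\ (forall t x y, 0 < t -> F x -> F y -> 0 <= p t x y),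
      (forall t x y, 0 < t -> F x -> F y -> p t x y = p t y x) /\
      (forall t x, 0 < t -> F x -> measurable_fun F (p t x)),
      (forall t x, 0 < t -> F x -> (\int[nu]_(y in F) (p t x y)%:E = 1)%E),
      (forall s t x z, 0 < s -> 0 < t -> F x -> F z ->
         (p (s + t) x z)%:E = (\int[nu]_(y in F) (p s x y * p t y z)%:E)%E)
    & (forall t x y, 0 < t -> F x -> F y -> forall eps, 0 < eps ->
         exists2 delta, 0 < delta & forall t' x' y', 0 < t' -> F x' -> F y' ->
           `|t - t'| < delta -> dE x x' < delta -> dE y y' < delta ->
           `|p t' x' y' - p t x y| < eps)].

Definition dprob F nu (p : R -> E -> E -> R) (t : R) (x : E) (A : set E) : R :=
  fine (\int[nu]_(y in A `&` F) (p t x y)%:E)%E.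
End LimitDefs.

Section Assumptions.
Context {R : realType} {d : measure_display} {E : measurableType d}.

Definition assumption_A1 (dE : E -> E -> R) (F : set E) (rho : E)
  (nu : {measure set E -> \bar R}) (p : R -> E -> E -> R)
  (V : nat -> set E) (mu : nat -> E -> E -> R) (alpha beta gamma : nat -> R)
  (g : nat -> E -> E) : Prop :=
  [/\
      (exists2 c1 : R, 0 < c1 & forall n x y, V n x -> V n y ->
          c1 * alpha n * dE x y <= gdist (mu n) x y)
      /\ (exists atil : nat -> R, (forall n, 0 <= atil n) /\
           (forall eps : R, 0 < eps -> exists N, forall n, (N <= n)%N ->
               atil n <= eps * alpha n) /\
           (forall r : R, 0 < r -> exists c2 : R, exists n0, forall n x y,
               (n0 <= n)%N -> V n x -> V n y ->
               mball dE rho r x -> mball dE rho r y ->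
               gdist (mu n) x y <= c2 * alpha n * dE x y + atil n)),
      (forall r : R, 0 < r -> forall eps : R, 0 < eps -> exists N, forall n,
          (N <= n)%N -> forall x, F x -> dE rho x < r ->
          exists2 v, V n v & dE x v < eps),
      (forall x (r : R), F x -> 0 < r ->
          ((beta n)^-1%:E * gmeasure (V n) (mu n) (mball dE x r))%E
            @[n --> \oo] --> nu (mball dE x r))
    &
      exists Fs : set E, Fs `<=` F /\
        (forall x (e : R), F x -> 0 < e -> exists2 z, Fs z & dE x z < e) /\
        (forall a b : R, 0 < a -> a <= b -> forall x y (r : R),
          Fs x -> F y -> 0 < r -> forall eps : R, 0 < eps ->
          exists N, forall n, (N <= n)%N -> forall t, a <= t <= b ->
            `|gprob (mu n) (Num.truncn (gamma n * t)) (g n x) (mball dE y r)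
              - dprob F nu p t x (mball dE y r)| < eps)].

Definition assumption_A2 (rho : E) (V : nat -> set E) (mu : nat -> E -> E -> R)
  (alpha beta gamma : nat -> R) : Prop :=
  forall a b : R, 0 < a -> a <= b -> forall r : R, 0 < r ->
  forall eps : R, 0 < eps -> exists2 delta : R, 0 < delta &
    exists N, forall n, (N <= n)%N -> forall x y z,
      gball (V n) (mu n) rho (alpha n * r) x ->
      gball (V n) (mu n) rho (alpha n * r) y ->
      gball (V n) (mu n) rho (alpha n * r) z ->
      gdist (mu n) y z <= alpha n * delta ->
      forall t, a <= t <= b ->
        beta n * `|gq (mu n) (Num.truncn (gamma n * t)) x y
                   - gq (mu n) (Num.truncn (gamma n * t)) x z| <= eps.
End Assumptions.

(* Main.v *)
(** Fix [x] in the dense set [F^*] and [y] in [F]. Averaging (d) over the times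
    [t] and [t + 1/gamma n] gives the convergence of the sum of
    [q^n_{gamma n t}(g_n x, z) nu^n(z)] over the vertices [z] in a small ball around [y].
    Equicontinuity of [q^n] and continuity of [p] replace both sides by the value at [y]
    times the mass of the ball, and (c) allows division by this mass. Reversibility makes
    [q^n] symmetric, hence equicontinuous in both variables, so that the convergence
    extends to a neighbourhood of each pair in [F * F]; compactness concludes. *)
Require Import Defs.
From HB Require Import structures.
From mathcomp Require Import all_boot all_order all_algebra.
From mathcomp Require Import all_classical all_reals all_analysis.
From mathcomp Require Import measurable_realfun ring lra.
Import Order.TTheory GRing.Theory Num.Theory.
Local Open Scope classical_set_scope.
Local Open Scope ring_scope.

(** * Reversibility and finiteness for the walk on a weighted graph *)

Section WeightedGraph.
Context {R : realType} {E : choiceType} (V : set E) (mu : E -> E -> R).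
Hypothesis HG : wgraph V mu.

Lemma wgraph_sym x y : mu x y = mu y x.
Proof. by case: HG => -[]. Qed.

Lemma wgraph_ge0 x y : 0 <= mu x y.
Proof. by case: HG => -[]. Qed.

Lemma wgraph_vertexr x y : 0 < mu x y -> V y.
Proof. by case: HG => _ [+ _] _ _ _ => /[apply] -[]. Qed.

Lemma wgraph_vertexl x y : 0 < mu x y -> V x.
Proof. by rewrite wgraph_sym; exact: wgraph_vertexr. Qed.

Lemma finite_neighbours x : finite_set [set y | 0 < mu x y].
Proof.
have [Vx|nVx] := pselect (V x); first by case: HG => _ _ + _ _; apply.
by rewrite (_ : mkset _ = set0) // -subset0 => y /= /wgraph_vertexl.
Qed.

Lemma vweight_ge0 x : 0 <= vweight mu x.
Proof. by apply: fsumr_ge0 => y _; exact: wgraph_ge0. Qed.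

(** Connectedness and the existence of a second vertex give a walk of positive length from [x],
    whose first edge leads to a neighbour. This is what makes [vweight] positive on [V]. *)
Lemma exists_neighbour x : V x -> exists y, 0 < mu x y.
Proof.
move=> Vx; have [_ _ _ conn [u [v [Vu Vv uv]]]] := HG.
have [w Vw xw] : exists2 w, V w & x <> w.
  by have [xu|xu] := pselect (x = u); [exists v => //; rewrite xu|exists u].
have [[|n] [f [f0 fn fw]]] := conn x w Vx Vw.
  by case: xw; rewrite -f0 -fn.
by exists (f 1%N); rewrite -f0; exact: fw.
Qed.

Lemma vweight_gt0 x : V x -> 0 < vweight mu x.
Proof.
move=> /exists_neighbour[y xy]; rewrite lt_neqAle vweight_ge0 andbT eq_sym.
apply/eqP => /pfsumr_eq0 h; suff : mu x y = 0 by move/eqP; rewrite gt_eqF.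
by apply: h => //; [exact: finite_neighbours|move=> z _; exact: wgraph_ge0].
Qed.

Lemma gstep_out m x y : V x -> ~ V y -> gstep mu m x y = 0.
Proof.
elim: m x => [|m IH] x Vx nVy /=.
  by case: asboolP => // xy; case: nVy; rewrite -xy.
apply: fsbig1 => z xz; rewrite IH ?mulr0 //; exact: wgraph_vertexr xz.
Qed.

Lemma gstepS m x y :
  gstep mu m.+1 x y = \sum_(z \in [set z | 0 < mu x z]) gtrans mu x z * gstep mu m z y.
Proof. by []. Qed.

Lemma gstep1 x y : gstep mu 1 x y = gtrans mu x y.
Proof.
rewrite /= (fsbig_widen [set z | 0 < mu x z] setT) //.
  rewrite -(fsbig_widen [set y] setT) //; first by rewrite fsbig_set1 asboolT // mulr1.
  by move=> z [_ /= zy]; rewrite asboolF // mulr0.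
move=> z [_ /= /negP]; rewrite lt_neqAle wgraph_ge0 andbT negbK => /eqP xz.
by rewrite /gtrans -xz mul0r mul0r.
Qed.

(** [gstep] is defined by its first step; exchanging two finite sums gives the decomposition along
    the last step, which reversibility needs. *)
Lemma gstepSr m x y :
  gstep mu m.+1 x y = \sum_(z \in [set z | 0 < mu y z]) gstep mu m x z * gtrans mu z y.
Proof.
elim: m x => [|m IH] x.
  rewrite gstep1 (fsbig_widen [set z | 0 < mu y z] setT) //.
    rewrite -(fsbig_widen [set x] setT) //; first by rewrite fsbig_set1 /= asboolT // mul1r.
    by move=> z [_ /= zy]; rewrite asboolF ?mul0r //; exact: nesym.
  move=> z [_ /= /negP]; rewrite lt_neqAle wgraph_ge0 andbT negbK => /eqP yz.
  by rewrite /gtrans [mu z y]wgraph_sym -yz mul0r mulr0.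
rewrite gstepS; under eq_fsbigr do rewrite IH mulr_fsumr.
rewrite exchange_fsbig; [|exact: finite_neighbours..].
apply: eq_fsbigr => z _; rewrite gstepS mulr_fsuml.
by apply: eq_fsbigr => w _; rewrite mulrA.
Qed.

(** Detailed balance for one step is the symmetry of [mu]. Induction on [m] propagates it, expanding
    the left side along the first step and the right side along the last. *)
Lemma gstep_rev m x y :
  V x -> V y -> vweight mu x * gstep mu m x y = vweight mu y * gstep mu m y x.
Proof.
elim: m x => [|m IH] x Vx Vy.
  rewrite /=; have [->//|xy] := pselect (x = y).
  by rewrite !asboolF ?mulr0 //; exact: nesym.
rewrite [gstep mu m.+1 y x]gstepSr gstepS !mulr_fsumr.
apply: eq_fsbigr => z; rewrite inE /= => xz.
have Vz := wgraph_vertexr _ _ xz.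
have wx : vweight mu x != 0 by rewrite gt_eqF // vweight_gt0.
have wz : vweight mu z != 0 by rewrite gt_eqF // vweight_gt0.
rewrite mulrA [in RHS]mulrA -IH // /gtrans [mu z x]wgraph_sym.
by field; apply/andP; split.
Qed.

Lemma gdens_sym m x y : V x -> V y -> gdens mu m x y = gdens mu m y x.
Proof.
move=> Vx Vy; rewrite /gdens.
have wx : vweight mu x != 0 by rewrite gt_eqF // vweight_gt0.
have wy : vweight mu y != 0 by rewrite gt_eqF // vweight_gt0.
by apply/eqP; rewrite eqr_div // mulrC gstep_rev // mulrC.
Qed.

Lemma gq_sym m x y : V x -> V y -> gq mu m x y = gq mu m y x.
Proof. by move=> Vx Vy; rewrite /gq !(gdens_sym _ x y). Qed.

Lemma gprobE m x A : V x ->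
  gprob mu m x A = \sum_(z \in A `&` V) gdens mu m x z * vweight mu z.
Proof.
move=> Vx; rewrite /gprob -(fsbig_widen (A `&` V) A); [|exact: subIsetl|].
  apply: eq_fsbigr => z; rewrite inE => -[_ Vz].
  by rewrite /gdens divfK // gt_eqF // vweight_gt0.
by move=> z [Az nAVz]; apply: gstep_out => // Vz; apply: nAVz.
Qed.

Lemma gmeasure_fin A : finite_set (A `&` V) ->
  gmeasure V mu A = (\sum_(z \in A `&` V) vweight mu z)%:E.
Proof.
move=> fA; rewrite /gmeasure esum_fset //.
  by rewrite !fsbig_finite // sumEFin.
by move=> z _; rewrite lee_fin vweight_ge0.
Qed.

Lemma finite_gwalk x n : finite_set [set y | gwalk mu x y n].
Proof.
elim: n => [|n IH].
  apply: (sub_finite_set (B := [set x])); last exact: finite_set1.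
  by move=> y [f [<- <- _]].
apply: (sub_finite_set
    (B := \bigcup_(z in [set z | gwalk mu x z n]) [set y | 0 < mu z y])).
  move=> y [f [f0 fn fw]]; exists (f n); last by rewrite /= -fn; exact: fw.
  by exists f; split => // i /ltnW; exact: fw.
by apply: bigcup_finite => // z _; exact: finite_neighbours.
Qed.

(** A strict bound on the infimum yields an actual walk with fewer than [M + 1] steps, and walks of
    bounded length from [x] end in finitely many vertices. *)
Lemma finite_gdist_ball x (M : R) :
  V x -> finite_set [set y | V y /\ gdist mu x y <= M].
Proof.
move=> Vx; set N := (Num.truncn (M + 1)).+1.
apply: (sub_finite_set (B := \bigcup_(k in `I_N) [set y | gwalk mu x y k])); last first.
  by apply: bigcup_finite => [|k _]; [exact: finite_II|exact: finite_gwalk].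
move=> y [Vy xy]; have [_ _ _ /(_ x y Vx Vy) [n0 wn0] _] := HG.
have : gdist mu x y < M + 1 by lra.
move/inf_lt => -[|_ [n wn <-] nM]; first by exists n0%:R, n0.
exists n => //=; rewrite -(ltr_nat R); apply: (lt_trans nM); exact: truncnS_gt.
Qed.

(** Since [gq] averages two consecutive densities, the mean of two consecutive laws of [A] is the
    sum of [gq] over [A] against the vertex weights. Freezing [gq] at [y] costs at most [c] times
    the mass. *)
Lemma gprob_avg_gq m x y A (c : R) : V x -> finite_set (A `&` V) ->
  (forall z, A z -> V z -> `|gq mu m x z - gq mu m x y| <= c) ->
  `|(gprob mu m x A + gprob mu m.+1 x A) / 2
     - gq mu m x y * \sum_(z \in A `&` V) vweight mu z|
  <= c * \sum_(z \in A `&` V) vweight mu z.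
Proof.
move=> Vx fA qc; rewrite !gprobE // !fsbig_finite // -big_split /= mulr_suml.
rewrite !mulr_sumr -sumrB; apply: (le_trans (ler_norm_sum _ _ _)).
rewrite big_seq [leRHS]big_seq; apply: ler_sum => z.
rewrite in_fset_set // inE => -[Az Vz].
rewrite -mulrDl mulrAC -/(gq mu m x z) -mulrBl normrM (ger0_norm (vweight_ge0 z)).
by rewrite ler_wpM2r ?vweight_ge0 // qc.
Qed.

End WeightedGraph.

(** * Compactness: from local to uniform eventual statements *)

Section MetricSpace.
Context {R : realType} {E : Type} (dE : E -> E -> R).
Hypothesis HdE : is_metric dE.

Lemma is_metric_xx x : dE x x = 0.
Proof. by case: HdE => _ h _ _; apply/h. Qed.

Lemma is_metric_sym x y : dE x y = dE y x.
Proof. by case: HdE. Qed.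

Lemma is_metric_triangle y x z : dE x z <= dE x y + dE y z.
Proof. by case: HdE. Qed.

Lemma mopen_mball x (s : R) : mopen dE (mball dE x s).
Proof.
move=> y xy; exists (s - dE x y); first by rewrite subr_gt0.
by move=> z yz; have := is_metric_triangle y x z; move: yz; rewrite /mball /=; lra.
Qed.

Lemma mopen_setC_mcball x (s : R) : mopen dE (~` mcball dE x s).
Proof.
move=> y /= /negP; rewrite -ltNge => xy; exists (dE x y - s); first by rewrite subr_gt0.
move=> z; rewrite /mball /mcball /= => yz; apply/negP; rewrite -ltNge.
by have := is_metric_triangle z x y; rewrite (is_metric_sym z y); lra.
Qed.

Lemma mcompact_eventually (K : set E) (Q : nat -> E -> Prop) :
  mcompact dE K ->
  (forall x0, K x0 -> exists2 delta : R, 0 < delta & exists N, forall n, (N <= n)%N ->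
     forall x, K x -> dE x0 x < delta -> Q n x) ->
  exists N, forall n, (N <= n)%N -> forall x, K x -> Q n x.
Proof.
move=> cK hQ.
(* The cover is indexed by all triples of centre, radius and rank, with an empty set where [good]
   fails, so no choice of radii or ranks is required. *)
pose good (i : E * R * nat) := forall n, (i.2 <= n)%N ->
  forall x, K x -> dE i.1.1 x < i.1.2 -> Q n x.
have [||J [finJ KJ]] := cK (E * R * nat)%type
    (fun i => [set x | good i /\ mball dE i.1.1 i.1.2 x]).
- move=> i x [gi /mopen_mball[e e0 sub]]; exists e => // y /sub ?.
  by split.
- move=> x Kx; have [delta delta0 [N hN]] := hQ x Kx.
  by exists (x, delta, N) => //; split=> //; rewrite /mball /= is_metric_xx.
have [N JN] : exists N, forall i, J i -> (i.2 <= N)%N.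
  have /finite_seqP[ks Jks] := finite_image snd finJ.
  exists (\max_(k <- ks) k)%N => i Ji; apply: leq_bigmax_seq => //.
  by have : (snd @` J) i.2 by [exists i]; rewrite Jks.
exists N => n Nn x Kx; have [i Ji [gi ix]] := KJ x Kx.
by apply: gi => //; exact: leq_trans (JN i Ji) Nn.
Qed.

(** Compactness is used once per variable. For fixed [x0], one integer [k] encodes both the rank and
    the radius [1/(k+1)] around [x0], so that the inner application in [y] makes both uniform. *)
Lemma mcompact_eventually2 (K : set E) (Q : nat -> E -> E -> Prop) :
  mcompact dE K ->
  (forall x0 y0, K x0 -> K y0 -> exists2 delta : R, 0 < delta & exists N,
     forall n, (N <= n)%N -> forall x y, K x -> K y ->
     dE x0 x < delta -> dE y0 y < delta -> Q n x y) ->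
  exists N, forall n, (N <= n)%N -> forall x y, K x -> K y -> Q n x y.
Proof.
move=> cK hQ.
have [||N hN] := @mcompact_eventually K (fun n x => forall y, K y -> Q n x y).
- exact: cK.
- move=> x0 Kx0.
  have [||k hk] := @mcompact_eventually K (fun k y => forall n, (k <= n)%N ->
      forall x, K x -> dE x0 x < k.+1%:R^-1 -> Q n x y).
  + exact: cK.
  + move=> y0 Ky0; have [delta delta0 [N hN]] := hQ x0 y0 Kx0 Ky0.
    exists delta => //; exists (maxn N (Num.truncn delta^-1)) => k.
    rewrite geq_max => /andP[Nk dk] y Ky y0y n kn x Kx x0x.
    apply: hN => //; first exact: leq_trans kn.
    apply: (lt_le_trans x0x); rewrite invf_ple ?posrE ?ltr0n //.
    by apply: (le_trans (ltW (truncnS_gt _))); rewrite ler_nat.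
  exists k.+1%:R^-1; first by rewrite invr_gt0 ltr0n.
  by exists k => n kn x Kx x0x y Ky; apply: (hk k).
by exists N => n Nn x y Kx Ky; exact: hN.
Qed.

End MetricSpace.

(** * Masses of balls and continuity of the transition density *)

Section TransitionDensity.
Context {R : realType} {d : measure_display} {E : measurableType d}.
Context (dE : E -> E -> R) (F : set E) (nu : {measure set E -> \bar R}).
Context (p : R -> E -> E -> R).
Hypothesis HdE : is_metric dE.
Hypothesis Hborel : (@measurable d E) = <<s [set U | mopen dE U] >>.
Hypothesis HF : forall x (s : R), 0 < s -> mcompact dE (F `&` mcball dE x s).
Hypothesis Hnu : radon_full_support dE F nu.
Hypothesis Hp : sym_transition_density dE F nu p.

Lemma measurable_mopen U : mopen dE U -> measurable U.
Proof. by move=> oU; rewrite Hborel; exact: sub_sigma_algebra. Qed.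

Lemma measurable_mball x s : measurable (mball dE x s).
Proof. exact/measurable_mopen/mopen_mball. Qed.

Lemma measurable_mcball x s : measurable (mcball dE x s).
Proof.
by rewrite -[mcball _ _ _]setCK; apply/measurableC/measurable_mopen/mopen_setC_mcball.
Qed.

Let mF : measurable F. Proof. by case: Hnu => -[]. Qed.

Let nuF A : measurable A -> nu A = nu (A `&` F).
Proof. by case: Hnu => -[_ +] _ _ _ _; apply. Qed.

(** Within [F] the open ball lies in a compact closed one, which has finite mass. *)
Lemma nu_mball_fin_num x s : 0 < s -> nu (mball dE x s) \is a fin_num.
Proof.
move=> s0; rewrite ge0_fin_numE // nuF; last exact: measurable_mball.
have [_ cfin _ _ _] := Hnu.
apply: le_lt_trans (cfin (F `&` mcball dE x s) _ _); last 2 first.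
- exact: subIsetl.
- exact: HF.
rewrite le_measure ?inE //.
- by apply: measurableI => //; exact: measurable_mball.
- by apply: measurableI => //; exact: measurable_mcball.
- by move=> y [/ltW xy Fy].
Qed.

Lemma fine_nu_mball_gt0 x s : F x -> 0 < s -> 0 < fine (nu (mball dE x s)).
Proof.
move=> Fx s0; rewrite fine_gt0 // ltey_eq nu_mball_fin_num // andbT.
by rewrite nuF; [case: Hnu => _ _ _ _; apply|exact: measurable_mball].
Qed.

Section Ball.
Context (t : R) (x y : E) (s : R).
Hypotheses (t0 : 0 < t) (Fx : F x) (Fy : F y) (s0 : 0 < s).
Let B := mball dE y s.

Let mBF : measurable (B `&` F).
Proof. by apply: measurableI => //; exact: measurable_mball. Qed.

Let mp : measurable_fun F (fun z => (p t x z)%:E).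
Proof. by apply: measurableT_comp => //; case: Hp => _ [_ +] _ _ _; apply. Qed.

Let mpB : measurable_fun (B `&` F) (fun z => (p t x z)%:E).
Proof. by apply: measurable_funS mp => //; exact: subIsetr. Qed.

Let p0 z : F z -> 0 <= p t x z.
Proof. by case: Hp => + _ _ _ _; apply. Qed.

Lemma integral_mball_le1 : (\int[nu]_(z in B `&` F) (p t x z)%:E <= 1)%E.
Proof.
have <- : (\int[nu]_(z in F) (p t x z)%:E = 1)%E by case: Hp => _ _ + _ _; apply.
by apply: ge0_subset_integral => //; exact: subIsetr.
Qed.

Lemma integral_mball_fin_num : (\int[nu]_(z in B `&` F) (p t x z)%:E)%E \is a fin_num.
Proof.
rewrite ge0_fin_numE; first exact: le_lt_trans integral_mball_le1 (ltry _).
by apply: integral_ge0 => z [_ Fz]; rewrite lee_fin p0.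
Qed.

Lemma dprob_mball_le1 : dprob F nu p t x B <= 1.
Proof.
by rewrite -lee_fin fineK ?integral_mball_fin_num // integral_mball_le1.
Qed.

Lemma dprob_mball_ge0 : 0 <= dprob F nu p t x B.
Proof.
by apply/fine_ge0/integral_ge0 => z [_ Fz]; rewrite lee_fin p0.
Qed.

Lemma dprob_mball_approx (c e : R) :
  (forall z, F z -> dE y z < s -> `|p t x z - c| <= e) ->
  `|dprob F nu p t x B - c * fine (nu B)| <= e * fine (nu B).
Proof.
move=> pc.
have nuBE : nu (B `&` F) = (fine (nu B))%:E.
  by rewrite fineK ?nu_mball_fin_num // -nuF //; exact: measurable_mball.
have m0 : 0 <= fine (nu B) by apply: ltW; exact: fine_nu_mball_gt0.
have up : dprob F nu p t x B <= (c + e) * fine (nu B).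
  rewrite -lee_fin fineK ?integral_mball_fin_num // EFinM -nuBE -integral_cst //.
  apply: ge0_le_integral => //; first by move=> z [_ Fz]; rewrite lee_fin p0.
  move=> z [Bz Fz]; rewrite lee_fin.
  by have := pc z Fz Bz; rewrite ler_norml; lra.
have lo : (c - e) * fine (nu B) <= dprob F nu p t x B.
  (* Monotonicity of the integral is applied to non-negative functions; if [c - e] is negative, the
     lower bound follows from [dprob] being non-negative. *)
  have [ce|/ltW ce] := leP 0 (c - e); last first.
    by apply: le_trans dprob_mball_ge0; rewrite mulr_le0_ge0.
  rewrite -lee_fin fineK ?integral_mball_fin_num // EFinM -nuBE -integral_cst //.
  apply: ge0_le_integral => //.
  move=> z [Bz Fz]; rewrite lee_fin.
  by have := pc z Fz Bz; rewrite ler_norml; lra.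
by rewrite ler_norml; apply/andP; split; nra.
Qed.

End Ball.

(** Compactness of [[a, b]] turns continuity at each [t] into one [delta] for all [t]. The time [t']
    may leave [[a, b]], as it does after a shift by one step of the walk. *)
Lemma density_continuous_uniform_time (a b : R) x y (eps : R) :
  0 < a -> F x -> F y -> 0 < eps ->
  exists2 delta, 0 < delta & forall t t' x' y', a <= t <= b -> 0 < t' -> F x' -> F y' ->
    `|t - t'| < delta -> dE x x' < delta -> dE y y' < delta ->
    `|p t' x' y' - p t x y| < eps.
Proof.
move=> a0 Fx Fy eps0.
have /compact_near_coveringP cov := @segment_compact R a b.
pose P (delta t : R) := forall t' x' y', 0 < t' -> F x' -> F y' ->
    `|t - t'| < delta -> dE x x' < delta -> dE y y' < delta ->
    `|p t' x' y' - p t x y| < eps.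
have dxx : dE x x = 0 by apply: is_metric_xx.
have dyy : dE y y = 0 by apply: is_metric_xx.
suff : \forall delta \near 0^'+, `[a, b] `<=` P delta.
  move=> [delta /= delta0 hdelta]; exists (delta / 2); first by rewrite divr_gt0.
  move=> t t' x' y' tab; apply: hdelta; rewrite /= ?in_itv //=.
    by rewrite sub0r normrN gtr0_norm ?divr_gt0 // ltr_pdivrMr //; lra.
  by rewrite divr_gt0.
apply: cov => t /=; rewrite in_itv /= => /andP[at_ _].
have t0 : 0 < t by exact: lt_le_trans at_.
have [_ _ _ _ /(_ t x y t0 Fx Fy (eps / 2) (divr_gt0 eps0 (ltr0n _ 2)))] := Hp.
move=> [e e0 he].
(* Both [p t' x' y'] and [p u x y] are compared with the value at the centre [t], hence the halves.
   The minimum with [t] keeps [u] positive. *)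
exists ([set u | `|t - u| < Num.min (e / 2) t], [set delta | delta < e / 2]).
  split; last by apply: nbhs_right_lt; rewrite divr_gt0.
  apply/nbhs_ballP; exists (Num.min (e / 2) t) => //=.
  by rewrite lt_min t0 andbT divr_gt0.
move=> [u delta] /= [tu de] t' x' y' t'0 Fx' Fy' ut' xx' yy'.
move: tu; rewrite lt_min => /andP[tu ut].
have u0 : 0 < u by move: ut; rewrite ltr_norml; lra.
have h1 : `|p t' x' y' - p t x y| < eps / 2.
  apply: he => //; [|lra|lra].
  by apply: le_lt_trans (ler_distD u _ _) _; lra.
have h2 : `|p u x y - p t x y| < eps / 2.
  by apply: he => //; [lra|rewrite dxx|rewrite dyy].
by move: h1 h2; rewrite !ltr_norml; lra.
Qed.

End TransitionDensity.

Lemma cvgy_ge_eventually (R : realType) (u : nat -> R) :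
  u n @[n --> \oo] --> +oo -> forall M, exists N, forall n, (N <= n)%N -> M <= u n.
Proof. by move=> /cvgryPge h M; have [N _ hN] := h M; exists N. Qed.

(** Adding [1 / gamma n] to the time thus advances the walk by exactly one step. *)
Lemma truncn_add1 (R : realType) (x : R) : 0 <= x -> Num.truncn (x + 1) = (Num.truncn x).+1.
Proof.
move=> x0; apply: truncn_def; have /andP[lo hi] := truncn_itv x0.
by rewrite -(natr1 (Num.truncn x)) -(natr1 (Num.truncn x).+1) lerD2r ltrD2r lo hi.
Qed.

(** * Consequences of the assumptions and the local limit at a fixed pair *)

Section LocalLimit.
Context {R : realType} {d : measure_display} {E : measurableType d}.
Context (dE : E -> E -> R) (F : set E) (rho : E) (nu : {measure set E -> \bar R}).
Context (p : R -> E -> E -> R).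
Context (V : nat -> set E) (mu : nat -> E -> E -> R) (alpha beta gamma : nat -> R).
Context (g : nat -> E -> E).
Hypothesis HdE : is_metric dE.
Hypothesis Hborel : (@measurable d E) = <<s [set U | mopen dE U] >>.
Hypothesis HF : forall x (s : R), 0 < s -> mcompact dE (F `&` mcball dE x s).
Hypothesis Hnu : radon_full_support dE F nu.
Hypothesis Hp : sym_transition_density dE F nu p.
Hypothesis HG : forall n, wgraph (V n) (mu n).
Hypothesis HrhoV : forall n, V n rho.
Hypothesis Halpha : (forall n, 0 <= alpha n) /\ alpha n @[n --> \oo] --> +oo.
Hypothesis Hbeta : (forall n, 0 <= beta n) /\ beta n @[n --> \oo] --> +oo.
Hypothesis Hgamma : (forall n, 0 <= gamma n) /\ gamma n @[n --> \oo] --> +oo.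
Hypothesis Hg : forall n x, V n (g n x) /\ (forall v, V n v -> dE x (g n x) <= dE x v).
Hypothesis HA1 : assumption_A1 dE F rho nu p V mu alpha beta gamma g.
Hypothesis HA2 : assumption_A2 rho V mu alpha beta gamma.

Let tri := is_metric_triangle _ HdE.
Let dC := is_metric_sym _ HdE.
Let d0 x y : 0 <= dE x y. Proof. by case: HdE. Qed.
Let Vg n x : V n (g n x). Proof. by case: (Hg n x). Qed.

Lemma nearest_vertex_close (s e : R) : 0 < s -> 0 < e ->
  exists N, forall n, (N <= n)%N -> forall x, F x -> dE rho x < s -> dE x (g n x) < e.
Proof.
move=> s0 e0; have [_ /(_ s s0 e e0)[N hN] _ _] := HA1.
exists N => n Nn x Fx xs; have [v Vv xv] := hN n Nn x Fx xs.
by apply: le_lt_trans xv; case: (Hg n x) => _; apply.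
Qed.

Lemma gdist_le_metric (s e : R) : 0 < s -> 0 < e ->
  exists2 C, 0 <= C & exists N, forall n, (N <= n)%N -> 0 < alpha n /\
    forall x y, V n x -> V n y -> dE rho x < s -> dE rho y < s ->
    gdist (mu n) x y <= alpha n * (C * dE x y + e).
Proof.
move=> s0 e0; have [[_ [atil [_ [hatil hd]]]] _ _ _] := HA1.
have [c2 [N1 h1]] := hd s s0; have [N2 h2] := hatil e e0.
have [_ /cvgy_ge_eventually/(_ 1)[N3 h3]] := Halpha.
(* The sign of [c2] is not prescribed. *)
exists `|c2|; first by [].
exists (maxn N1 (maxn N2 N3)) => n; rewrite !geq_max => /and3P[/h1 {}h1 /h2 {}h2 /h3 {}h3].
split; first exact: lt_le_trans h3.
move=> x y Vx Vy xs ys; apply: (le_trans (h1 x y Vx Vy xs ys)).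
have a0 : 0 <= alpha n by case: Halpha.
have : 0 <= alpha n * dE x y * (`|c2| - c2).
  by rewrite !mulr_ge0 // subr_ge0 ler_norm.
by nra.
Qed.

(** The metric ball lies in a finite graph ball around [rho]; this lets the extended sum in
    [gmeasure] be read as a finite real sum. *)
Lemma finite_vertices_mball y (s : R) : 0 < s ->
  exists N, forall n, (N <= n)%N -> finite_set (mball dE y s `&` V n).
Proof.
move=> s0; set S := dE rho y + s; have S0 : 0 < S by rewrite ltr_wpDl.
have [C C0 [N hN]] := gdist_le_metric S 1 S0 ltr01.
exists N => n /hN[an0 h].
apply: (sub_finite_set (B := [set z | V n z /\ gdist (mu n) rho z <= alpha n * (C * S + 1)]));
  last exact: finite_gdist_ball.
move=> z [yz Vz]; split => //.
have zS : dE rho z < S by apply: le_lt_trans (tri y _ _) _; rewrite ltrD2l.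
apply: le_trans (h rho z _ _ _ _) _ => //; first by rewrite is_metric_xx.
by rewrite ler_pM2l // lerD2r ler_wpM2l // ltW.
Qed.

(** This is (Â2) with graph distances replaced by [dE], via the upper bound in (Â1)(a). *)
Lemma gq_equicontinuous (a b s e : R) : 0 < a -> a <= b -> 0 < s -> 0 < e ->
  exists2 delta : R, 0 < delta & exists N, forall n, (N <= n)%N -> forall x y z,
    V n x -> V n y -> V n z -> dE rho x < s -> dE rho y < s -> dE rho z < s ->
    dE y z < delta -> forall t, a <= t <= b ->
    beta n * `|gq (mu n) (Num.truncn (gamma n * t)) x y
               - gq (mu n) (Num.truncn (gamma n * t)) x z| <= e.
Proof.
move=> a0 ab s0 e0; have [C C0 [N1 h1]] := gdist_le_metric s 1 s0 ltr01.
(* The distance bound from [rho] is at most [alpha n * (C * s + 1)]; the constant 2 makes the graph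
   ball inequality strict. *)
have S0 : 0 < C * s + 2 by rewrite ltr_wpDl // mulr_ge0 // ltW.
have [delta delta0 [N2 h2]] := HA2 a b a0 ab (C * s + 2) S0 e e0.
have [D D0 [N3 h3]] := gdist_le_metric s (delta / 2) s0 (divr_gt0 delta0 (ltr0n _ 2)).
have D1 : 0 < D + 1 by rewrite ltr_wpDl.
(* Half of [delta] absorbs the additive error and half the term [D * dE y z]; [D + 1] is positive
   even if [D] is 0. *)
exists (delta / 2 / (D + 1)); first by rewrite !divr_gt0.
exists (maxn N1 (maxn N2 N3)) => n; rewrite !geq_max => /and3P[/h1 {}h1 /h2 {}h2 /h3 {}h3].
move=> x y z Vx Vy Vz xs ys zs yz.
have [an0 {}h1] := h1; have [_ {}h3] := h3.
have ball v : V n v -> dE rho v < s -> gball (V n) (mu n) rho (alpha n * (C * s + 2)) v.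
  move=> Vv vs; split => //; apply: le_lt_trans (h1 rho v _ _ _ _) _ => //.
    by rewrite is_metric_xx.
  rewrite ltr_pM2l //; have : 0 <= C * (s - dE rho v) by rewrite mulr_ge0 // subr_ge0 ltW.
  by nra.
apply: h2; [exact: ball..|].
apply: le_trans (h3 y z Vy Vz ys zs) _; rewrite ler_pM2l //.
move: yz; rewrite ltr_pdivlMr // => yz.
by have := d0 y z; nra.
Qed.

Lemma rescaled_mass_cvg y (s e : R) : F y -> 0 < s -> 0 < e ->
  exists N, forall n, (N <= n)%N -> finite_set (mball dE y s `&` V n) /\
    `|(beta n)^-1 * (\sum_(z \in mball dE y s `&` V n) vweight (mu n) z)
      - fine (nu (mball dE y s))| < e.
Proof.
move=> Fy s0 e0; have [N1 h1] := finite_vertices_mball y s s0.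
have [_ _ /(_ y s Fy s0) + _] := HA1.
rewrite -{1}(fineK (nu_mball_fin_num _ _ _ HdE Hborel HF Hnu y s s0)).
move=> /fine_cvgP[_ /cvgrPdist_lt/(_ e e0)[N2 _ h2]].
exists (maxn N1 N2) => n; rewrite geq_max => /andP[/h1 {}h1 /h2 /=].
by rewrite (gmeasure_fin _ _ (HG n)) // -EFinM /= distrC.
Qed.

(* The ball around [y] is taken so small that, by equicontinuity, the averaged law
   of the walk on it is [gq] at [g n y] times its mass. *)
Lemma local_limit_pointwise (a b e : R) x y :
  0 < a -> a <= b -> F x -> F y -> 0 < e ->
  (forall a b s : R, 0 < a -> a <= b -> 0 < s -> forall eps : R, 0 < eps ->
     exists N, forall n, (N <= n)%N -> forall t, a <= t <= b ->
       `|gprob (mu n) (Num.truncn (gamma n * t)) (g n x) (mball dE y s)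
         - dprob F nu p t x (mball dE y s)| < eps) ->
  exists N, forall n, (N <= n)%N -> forall t, a <= t <= b ->
    `|beta n * gq (mu n) (Num.truncn (gamma n * t)) (g n x) (g n y) - p t x y| <= e * 7.
Proof.
move=> a0 ab Fx Fy e0 lawx.
have [del1 del10 hp] := density_continuous_uniform_time _ _ _ _ HdE Hp a b x y e a0 Fx Fy e0.
set r0 := dE rho x + dE rho y + 2.
have r00 : 0 < r0 by have := d0 rho x; have := d0 rho y; rewrite /r0; lra.
have [del2 del20 [N2 h2]] := gq_equicontinuous a b r0 e a0 ab r00 e0.
set s := Num.min del1 (Num.min (del2 / 2) 1).
have s0 : 0 < s by rewrite !lt_min del10 ltr01 divr_gt0.
have [sdel1 sdel2 s1] : [/\ s <= del1, s <= del2 / 2 & s <= 1].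
  by split; rewrite !ge_min lexx ?orbT.
set B := mball dE y s; set m := fine (nu B).
have m0 : 0 < m by apply: fine_nu_mball_gt0 Fy s0.
(* [P] bounds [p t x y]: the ball has probability at most 1, and this probability is at least
   [(p t x y - e) * m]. *)
set P := m^-1 + e.
have P0 : 0 < P by rewrite addr_gt0 // invr_gt0.
(* The first tolerance keeps the rescaled mass [M] above [m / 2]; the second makes
   [p t x y * (M - m)] at most [e * m] in absolute value. *)
have eta0 : 0 < Num.min (m / 2) (e * m / P) by rewrite lt_min !divr_gt0 // mulr_gt0.
have [N3 h3] := rescaled_mass_cvg y s _ Fy s0 eta0.
have gam0 : 0 < Num.min (del2 / 2) 1 by rewrite lt_min ltr01 divr_gt0.
have [N4 h4] := nearest_vertex_close r0 _ r00 gam0.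
(* The interval is enlarged to contain [t + 1 / gamma n]. *)
have [N5 h5] := lawx a (b + 1) s a0 (le_trans ab (ler_wpDr ler01 (lexx b))) s0
  (e * m) (mulr_gt0 e0 m0).
have [_ /cvgy_ge_eventually/(_ (1 + del1^-1))[N6 h6]] := Hgamma.
have [_ /cvgy_ge_eventually/(_ 1)[N7 h7]] := Hbeta.
exists (maxn N2 (maxn N3 (maxn N4 (maxn N5 (maxn N6 N7))))) => n.
rewrite !geq_max => /and5P[/h2 {}h2 /h3 {}h3 /h4 {}h4 /h5 {}h5 /andP[/h6 {}h6 /h7 {}h7]].
move=> t tab; have /andP[at_ tb] := tab; have t0 : 0 < t by exact: lt_le_trans at_.
have bn0 : 0 < beta n by exact: lt_le_trans h7.
have d1V : 0 < del1^-1 by rewrite invr_gt0.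
have gn1 : 1 <= gamma n by apply: le_trans h6; rewrite lerDl ltW.
have gn0 : 0 < gamma n by exact: lt_le_trans gn1.
set t' := t + (gamma n)^-1.
have gV0 : 0 < (gamma n)^-1 by rewrite invr_gt0.
have gV1 : (gamma n)^-1 <= 1 by rewrite invf_le1.
have gVdel : (gamma n)^-1 < del1.
  by rewrite invf_plt ?posrE //; apply: lt_le_trans h6; rewrite ltrDr.
have t'0 : 0 < t' by rewrite addr_gt0.
set k := Num.truncn (gamma n * t).
have kS : Num.truncn (gamma n * t') = k.+1.
  by rewrite /t' mulrDr mulfV ?gt_eqF // truncn_add1 // mulr_ge0 // ltW.
have gx : dE rho (g n x) < r0.
  have xr : dE rho x < r0 by have := d0 rho y; rewrite /r0; lra.
  have := h4 x Fx xr; rewrite lt_min => /andP[_ h].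
  by have := tri x rho (g n x); have := d0 rho y; rewrite /r0; lra.
have yr : dE rho y < r0 by have := d0 rho x; rewrite /r0; lra.
have := h4 y Fy yr; rewrite lt_min => /andP[gy2 gy1].
have gy : dE rho (g n y) < r0.
  by have := tri y rho (g n y); have := d0 rho x; rewrite /r0; lra.
have [finB mass] := h3.
rewrite -/B -/m in mass.
set W := \sum_(z \in B `&` V n) vweight (mu n) z in mass *.
set q := gq (mu n) k (g n x) (g n y).
have avg : `|(gprob (mu n) k (g n x) B + gprob (mu n) k.+1 (g n x) B) / 2 - q * W|
    <= e / beta n * W.
  apply: gprob_avg_gq => // z yz Vz; rewrite ler_pdivlMr // mulrC.
  apply: h2 => //.
    have := tri y rho z; have := d0 rho x; move: yz; rewrite /B /mball /= /r0; lra.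
  by have := tri y z (g n y); rewrite (dC z y); move: yz; rewrite /B /mball /=; lra.
have yy0 : dE y y = 0 by exact: is_metric_xx.
have xx0 : dE x x = 0 by exact: is_metric_xx.
have Dt : `|dprob F nu p t x B - p t x y * m| <= e * m.
  apply: dprob_mball_approx => // z Fz yz; apply/ltW/hp => //.
  - by rewrite subrr normr0.
  - by rewrite xx0.
  - exact: lt_le_trans yz sdel1.
have Dt' : `|dprob F nu p t' x B - p t x y * m| <= e * m.
  apply: dprob_mball_approx => // z Fz yz; apply/ltW/hp => //.
  - by rewrite /t' opprD addrA subrr sub0r normrN gtr0_norm.
  - by rewrite xx0.
  - exact: lt_le_trans yz sdel1.
have Pt : `|gprob (mu n) k (g n x) B - dprob F nu p t x B| < e * m.
  by apply: h5; rewrite at_ (le_trans tb) // lerDl.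
have Pt' : `|gprob (mu n) k.+1 (g n x) B - dprob F nu p t' x B| < e * m.
  rewrite -kS; apply: h5; rewrite /t'; apply/andP; split; lra.
have D1 : dprob F nu p t x B <= 1 by exact: dprob_mball_le1.
have p0 : 0 <= p t x y by case: Hp => + _ _ _ _; apply.
set M := (beta n)^-1 * W in mass.
have qW : q * W = beta n * q * M by rewrite /M; field; rewrite gt_eqF.
have eW : e / beta n * W = e * M by rewrite /M; ring.
rewrite qW eW in avg.
move: mass; rewrite lt_min => /andP[mass2 massP].
have pM : `|p t x y * (M - m)| <= e * m.
  have pP : p t x y <= P.
    rewrite -(ler_pM2r m0) /P mulrDl mulVf ?gt_eqF //.
    by move: Dt; rewrite ler_norml; lra.
  rewrite normrM (ger0_norm p0); move: massP; rewrite ltr_pdivlMr // => massP.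
  by have := normr_ge0 (M - m); nra.
have mM : m <= 2 * M by move: mass2; rewrite ltr_norml; lra.
have M0 : 0 < M by lra.
(* After multiplication by [M] the error is [e * M] from [avg] and [e * m] each from the laws, the
   continuity of [p] and the mass; [m <= 2 * M] gives the factor 7. *)
rewrite -(ler_pM2r M0) -[X in _ * X <= _](gtr0_norm M0) -normrM.
set u := gprob _ _ _ _ in avg Pt; set v := gprob _ _ _ _ in avg Pt'.
have emM : e * m <= e * M * 2 by nra.
set w := dprob _ _ _ t _ _ in Dt Pt D1; set w' := dprob _ _ _ _ _ _ in Dt' Pt'.
rewrite mulrBr in pM; rewrite [_ * M]mulrBl.
move: avg pM Dt Dt' Pt Pt'; rewrite !ler_norml !ltr_norml.
set X1 := beta n * q * M; set X2 := p t x y * m; set X3 := p t x y * M.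
set X4 := e * M in emM *; set X5 := e * m in emM *.
rewrite [e * 7 * M](_ : _ = X4 * 7); last by rewrite /X4; ring.
by lra.
Qed.

End LocalLimit.

(** * From the dense set to uniform convergence on the ball *)

Theorem theorem5p1 (R : realType) (d : measure_display) (E : measurableType d)
  (dE : E -> E -> R) (F : set E) (rho : E) (nu : {measure set E -> \bar R})
  (p : R -> E -> E -> R)
  (V : nat -> set E) (mu : nat -> E -> E -> R) (alpha beta gamma : nat -> R)
  (g : nat -> E -> E) (a b r : R)
  (* (E, d_E) metric space with its Borel sigma-algebra *)
  (HdE : is_metric dE)
  (Hborel : (@measurable d E) = <<s [set U | mopen dE U] >>)
  (* F meets every closed ball in a compact set *)
  (HF : forall x (s : R), 0 < s -> mcompact dE (F `&` mcball dE x s))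
  (Hrho : F rho)
  (Hnu : radon_full_support dE F nu)
  (Hp : sym_transition_density dE F nu p)
  (* the graphs G^n *)
  (HG : forall n, wgraph (V n) (mu n))
  (HrhoV : forall n, V n rho)
  (* scaling sequences *)
  (Halpha : (forall n, 0 <= alpha n) /\ alpha n @[n --> \oo] --> +oo)
  (Hbeta : (forall n, 0 <= beta n) /\ beta n @[n --> \oo] --> +oo)
  (Hgamma : (forall n, 0 <= gamma n) /\ gamma n @[n --> \oo] --> +oo)
  (* g_n(x) is a d_E-closest vertex of G^n to x *)
  (Hg : forall n x, V n (g n x) /\ (forall v, V n v -> dE x (g n x) <= dE x v))
  (* the compact interval I = [a,b] in (0,oo) and r > 0 *)
  (Ha : 0 < a) (Hab : a <= b) (Hr : 0 < r)
  (HA1 : assumption_A1 dE F rho nu p V mu alpha beta gamma g)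
  (HA2 : assumption_A2 rho V mu alpha beta gamma) :
  forall eps : R, 0 < eps -> exists N : nat, forall n, (N <= n)%N ->
    forall x y, F x -> dE rho x < r -> F y -> dE rho y < r ->
    forall t, a <= t <= b ->
      `|beta n * gq (mu n) (Num.truncn (gamma n * t)) (g n x) (g n y)
        - p t x y| <= eps.
Proof.
have tri := is_metric_triangle _ HdE; have dC := is_metric_sym _ HdE.
have Vg n x : V n (g n x) by case: (Hg n x).
have [_ _ _ [Fs [FsF [Fsdense law]]]] := HA1.
(* The local limit contributes 7, and the bounds [q1], [q2], [p1], [p2] contribute 1 each. *)
move=> eps eps0; set e := eps / 11.
have e0 : 0 < e by rewrite divr_gt0.
pose Q n x y := forall t, a <= t <= b ->
  `|beta n * gq (mu n) (Num.truncn (gamma n * t)) (g n x) (g n y) - p t x y| <= eps.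
have [|N hN] := mcompact_eventually2 _ HdE _ Q (HF rho r Hr); last first.
  by exists N => n Nn x y Fx xr Fy yr; apply: hN => //; split => //; exact: ltW.
move=> x0 y0 [Fx0 /= x0r] [Fy0 /= y0r].
have [del1 del10 hp] :=
  density_continuous_uniform_time _ _ _ _ HdE Hp a b x0 y0 e Ha Fx0 Fy0 e0.
have s0 : 0 < r + 3 by lra.
have [del2 del20 [N2 h2]] := gq_equicontinuous _ _ _ _ _ _ _ _ _ _ _
  HdE HrhoV Halpha HA1 HA2 a b (r + 3) e Ha Hab s0 e0.
(* The longest chain, from [g n x] through [x], [x0], [x1] to [g n x1], has four links shorter than
   [c]. *)
set c := Num.min (del2 / 4) 1.
have c0 : 0 < c by rewrite lt_min ltr01 divr_gt0.
have [c1 c2] : c <= del2 / 4 /\ c <= 1 by split; rewrite !ge_min lexx ?orbT.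
set delta := Num.min del1 c.
have delta0 : 0 < delta by rewrite lt_min del10.
have delta1 : delta <= del1 by rewrite ge_min lexx.
have deltac : delta <= c by rewrite ge_min lexx orbT.
(* Only the starting point must lie in the dense set; [y0] is kept as the target. *)
have [x1 Fsx1 x01] := Fsdense x0 delta Fx0 delta0.
have Fx1 := FsF _ Fsx1.
have [N3 h3] := local_limit_pointwise _ _ _ _ _ _ _ _ _ _ _
  HdE Hborel HF Hnu Hp HG HrhoV Halpha Hbeta Hgamma Hg HA1 HA2
  a b e x1 y0 Ha Hab Fx1 Fy0 e0
  (fun a b s a0 ab s0 eps eps0 => law a b a0 ab x1 y0 s Fsx1 Fy0 s0 eps eps0).
have [N4 h4] := nearest_vertex_close _ _ _ _ _ _ _ _ _ _ _ Hg HA1 (r + 3) c s0 c0.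
exists delta => //; exists (maxn N2 (maxn N3 N4)) => n.
rewrite !geq_max => /and3P[/h2 {}h2 /h3 {}h3 /h4 {}h4].
move=> x y [Fx /= xr] [Fy /= yr] x0x y0y t tab.
have /andP[at_ _] := tab; have t0 : 0 < t by exact: lt_le_trans at_.
have b0 : 0 <= beta n by case: Hbeta.
have ball u v : F v -> dE rho u <= r -> dE u v < delta ->
    dE v (g n v) < c /\ dE rho (g n v) < r + 3.
  move=> Fv ur uv; have vr : dE rho v < r + 3 by have := tri u rho v; lra.
  have vg := h4 v Fv vr; split=> //.
  by have := tri u rho v; have := tri v rho (g n v); lra.
have xx : dE x x < delta by rewrite is_metric_xx.
have yy0 : dE y0 y0 < delta by rewrite is_metric_xx.
have [gx1 gx2] := ball x x Fx xr xx.
have [gx11 gx12] := ball x0 x1 Fx1 x0r x01.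
have [gy1 gy2] := ball y0 y Fy y0r y0y.
have [gy01 gy02] := ball y0 y0 Fy0 y0r yy0.
set k := Num.truncn (gamma n * t).
have q1 : beta n * `|gq (mu n) k (g n x) (g n y) - gq (mu n) k (g n x) (g n y0)| <= e.
  apply: h2 => //.
  have := tri y (g n y) (g n y0); have := tri y0 y (g n y0).
  by rewrite (dC _ y) (dC y y0); lra.
have q2 : beta n * `|gq (mu n) k (g n x) (g n y0) - gq (mu n) k (g n x1) (g n y0)| <= e.
  (* Symmetry moves the varying starting point to the second variable, where equicontinuity is
     available. *)
  rewrite !(gq_sym _ _ (HG n) k _ (g n y0)) //; apply: h2 => //.
  have := tri x (g n x) (g n x1); have := tri x1 x (g n x1); have := tri x0 x x1.
  by rewrite (dC _ x) (dC x x0); lra.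
have q3 := h3 t tab; rewrite -/k in q3.
have p1 : `|p t x1 y0 - p t x0 y0| < e.
  apply: hp => //; first by rewrite subrr normr0.
    exact: lt_le_trans x01 delta1.
  exact: lt_le_trans yy0 delta1.
have p2 : `|p t x y - p t x0 y0| < e.
  apply: hp => //; first by rewrite subrr normr0.
    exact: lt_le_trans x0x delta1.
  exact: lt_le_trans y0y delta1.
have bnorm u : beta n * `|u| = `|beta n * u| by rewrite normrM (ger0_norm b0).
move: q1 q2; rewrite !bnorm !mulrBr.
have -> : eps = e * 11 by rewrite /e; field.
by move: q3 p1 p2; rewrite !ler_norml !ltr_norml; lra.
Qed.
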